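(* Let $U$ be a universe of separations and let $\mathcal{S}=(S_1,\dots,S_n)$ be a compatible sequence of structurally submodular separation systems $S_1\subseteq S_2\subseteq\dots\subseteq S_n\subseteq U$. Let $\mathcal{P}$ be a robust set of profiles in $\mathcal{S}$. Then there is a nested set $N$ of separations in $U$ which efficiently distinguishes all the distinguishable profiles in $\mathcal{P}$, i.e. for every two profiles $P,Q\in\mathcal P$ that are distinguished by some separation in $S_n$, the set $N$ contains a separation that distinguishes $P$ and $Q$ efficiently.
   Context: A separation system is a poset $\vec S$ with an order-reversing involution $\vec s\mapsto \overleftarrow{s}$ (so $\vec r\le\vec s$ iff $\overleftarrow r\ge\overleftarrow s$). For $\vec s$ its underlying unoriented separation is $s=\{\vec s,\overleftarrow s\}$; $S$ denotes the set of unoriented separations of $\vec S$. A universe of separations is a separation system $\vec U$ which is a lattice with join $\vee$ and meet $\wedge$ (then $(\vec r\vee\vec s)^*=\overleftarrow r\wedge\overleftarrow s$). Two separations $r,s$ are nested if they have orientations with $\vec r\le\vec s$; otherwise they cross. A set of separations is nested if its elements are pairwise nested. The corner separations of $r,s$ are the separations $\vec r\vee\vec s$ (and their underlying unoriented separations) over all orientations $\vec r,\vec s$. A separation system $\vec S\subseteq\vec U$ is (structurally) submodular if for all $\vec r,\vec s\in\vec S$ at least one of $\vec r\vee\vec s$, $\vec r\wedge\vec s$ lies in $\vec S$. An orientation of a set $S$ of unoriented separations contains exactly one of $\vec s,\overleftarrow s$ for each $s\in S$; it is consistent if it contains no $\vec r,\vec s$ with $\overleftarrow r<\vec s$. A profile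 of $S$ is a consistent orientation $P$ of $S$ such that for all $\vec r,\vec s\in P$ we have $\overleftarrow r\wedge\overleftarrow s\notin P$. A sequence $S_1\subseteq\dots\subseteq S_n\subseteq U$ of submodular separation systems is compatible if for all $s_i\in S_i$ and $s_j\in S_j$ with $i\le j$, either $S_i$ contains at least two corner separations of $s_i$ and $s_j$, or $S_j$ contains at least three corner separations of $s_i$ and $s_j$. A profile in $\mathcal S$ is a profile of one of the $S_i$. A separation $s\in S_n$ distinguishes two profiles $P,Q$ in $\mathcal S$ if there are orientations with $\vec s\in P$ and $\overleftarrow s\in Q$; it distinguishes them efficiently if $s\in S_i$ for every $S_i$ which contains a separation that distinguishes $P$ and $Q$. A set $\mathcal P$ of profiles in $\mathcal S$ is robust if for all $P,Q,Q'\in\mathcal P$: for every $\vec r\in Q\cap Q'$ with $\overleftarrow r\in P$ and every $s$ which distinguishes $Q$ and $Q'$ efficiently, if $s\in S_j$ then there is an orientation $\vec s$ of $s$ such that either $\overleftarrow r\vee\vec s\in P$ or $\vec r\vee\vec s\in\vec S_j$.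
   Formalization: The set of profiles is assumed finite (automatic when U is finite); without finiteness the claim fails, e.g. for n=1, S_1=U the power set of the natural numbers with complementation, and all its profiles. *)

(* Defs.v *)
From HB Require Import structures.
From mathcomp Require Import all_boot all_order.
From mathcomp Require Import boolp classical_sets cardinality.

Set Implicit Arguments.
Unset Strict Implicit.
Unset Printing Implicit Defensive.

Import Order.TTheory.
Local Open Scope order_scope.

HB.mixin Record POrder_isSepSystem (d : Order.disp_t) T
    of Order.POrder d T := {
  flip : T -> T;
  flipK : involutive flip;
  leflip : forall r s : T, (flip r <= flip s) = (s <= r)
}.

#[short(type="sepSystemType")]
HB.structure Definition SepSystem (d : Order.disp_t) :=
  { T of Order.POrder d T & POrder_isSepSystem d T }.

#[short(type="universeType")]
HB.structure Definition SepUniverse (d : Order.disp_t) :=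
  { T of Order.Lattice d T & POrder_isSepSystem d T }.

(* An unoriented separation {s, flip s} is given by either of its             *)
(* orientations, and a set of unoriented separations by the set of all        *)
(* orientations of its elements, that is, by a flip-closed set.               *)
Section Separations.
Context {d : Order.disp_t} {U : universeType d}.
Implicit Types (r s t : U) (S N P Q : set U).

Definition orient (b : bool) s : U := if b then flip s else s.

Definition sep_system S := forall s, S s -> S (flip s).

Definition nested r s := exists b c, orient b r <= orient c s.

Definition nested_set N := forall r s, N r -> N s -> nested r s.

Definition submodular S :=
  forall r s, S r -> S s -> S (r `|` s) \/ S (r `&` s).

Definition corner r s (c : bool * bool) : U :=
  orient c.1 r `|` orient c.2 s.

(* The four corners are counted by choice of orientations. Counting them as   *)
(* elements instead would make a family containing the least element of U     *)
(* incompatible: all corners of that element with itself have the same        *)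
(* underlying separation.                                                     *)
Definition num_corners_in S r s : nat :=
  #|[pred c : bool * bool | `[< S (corner r s c) >]]|.

(* A degenerate separation, s = flip s, has a single orientation.             *)
Definition orientation_of S P :=
  (forall s, P s -> S s) /\
  forall s, S s ->
    (P s \/ P (flip s)) /\ (P s -> P (flip s) -> s = flip s).

Definition consistent P := forall r s, P r -> P s -> ~ (flip r < s).

Definition profile_of S P :=
  [/\ orientation_of S P, consistent P &
      forall r s, P r -> P s -> ~ P (flip r `&` flip s)].

Section Sequence.
(* The sequence S_1, ..., S_(n+1) is indexed from 0; its last term is         *)
(* S ord_max.                                                                 *)
Context {n : nat}.
Variable S : 'I_n.+1 -> set U.

Definition compatible :=
  forall i j : 'I_n.+1, (i <= j)%N ->
  forall si sj, S i si -> S j sj ->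
    (2 <= num_corners_in (S i) si sj)%N \/
    (3 <= num_corners_in (S j) si sj)%N.

Definition profile_in P := exists i, profile_of (S i) P.

Definition distinguishes s P Q :=
  S ord_max s /\ exists b, P (orient b s) /\ Q (flip (orient b s)).

Definition distinguishes_efficiently s P Q :=
  distinguishes s P Q /\
  forall i, (exists2 t, S i t & distinguishes t P Q) -> S i s.

Definition robust (PP : set (set U)) :=
  forall P Q Q', PP P -> PP Q -> PP Q' ->
  forall r, Q r -> Q' r -> P (flip r) ->
  forall s, distinguishes_efficiently s Q Q' ->
  forall j, S j s ->
  exists b, P (flip r `|` orient b s) \/ S j (r `|` orient b s).

Definition efficiently_distinguishes_all N (PP : set (set U)) :=
  forall P Q, PP P -> PP Q ->
    (exists s, distinguishes s P Q) ->
    exists2 s, N s & distinguishes_efficiently s P Q.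

End Sequence.
End Separations.

(* Main.v *)
Require Import Defs.
From HB Require Import structures.
From mathcomp Require Import all_boot all_order.
From mathcomp Require Import boolp classical_sets cardinality.

(** For distinguishable profiles [P] and [Q] let [A_PQ] be the set of the
    separations that distinguish them efficiently. Suppose that [r] in
    [A_PP'] and [s] in [A_QQ'] cross, where [P], [P'] are distinguished no later
    in the sequence than [Q], [Q']. If [r] distinguishes [Q] and [Q'], it lies
    in both sets. If not, [Q] and [Q'] orient [r] alike, and a corner on that
    side of [r] lies in [A_QQ'] as soon as it lies in the relevant [S_j].
    Otherwise, compatibility provides both corners on the other side of [r], and
    robustness puts one of these in [A_PP'].

    By induction, such a finite family of sets has a nested set of
    representatives: given nested representatives of all sets but one, take
    [x] in the remaining set [A] crossing as few of them as possible. If [x]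
    crosses [y] in [B], no corner of [x] and [y] is in [A], as it would cross
    fewer, so [B] contains [x] or such a corner. Hence every set contains an
    element nested with [x], and the induction applies to these elements. *)

Set Implicit Arguments.
Unset Strict Implicit.
Unset Printing Implicit Defensive.

Import Order.TTheory.
Local Open Scope order_scope.

Lemma ltn_count (T : eqType) (p q : pred T) (s : seq T) (x : T) :
  {in s, forall y, p y -> q y} -> x \in s -> q x -> ~~ p x ->
  (count p s < count q s)%N.
Proof.
move=> pq xs qx npx.
rewrite -[count q s]size_filter -(count_predC p (filter q s)).
rewrite !count_filter (@eq_in_count _ (predI p q) p) => [|y ys /=].
  rewrite -[ltnLHS]addn0 ltn_add2l -has_count.
  by apply/hasP; exists x => //=; rewrite npx.
by case: (boolP (p y)) => // /(pq y ys) ->.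
Qed.

(** * Nestedness, corners and the splinter lemma *)

Section Nestedness.
Context {d : Order.disp_t} {U : universeType d}.
Implicit Types (r s t : U) (A B : set U).

Lemma flip_join r s : flip (r `|` s) = flip r `&` flip s.
Proof.
apply/le_anti/andP; split; first by rewrite lexI !leflip leUl leUr.
rewrite -[leLHS]flipK leflip leUx -{1}[r]flipK -{2}[s]flipK.
by rewrite !leflip leIl leIr.
Qed.

Lemma orient_addb b c s : orient b (orient c s) = orient (b (+) c) s.
Proof. by case: b; case: c => //=; rewrite flipK. Qed.

Lemma flip_orient b s : flip (orient b s) = orient (~~ b) s.
Proof. by case: b => //=; rewrite flipK. Qed.

Lemma le_orientC b c r s :
  (orient b r <= orient c s) = (orient (~~ c) s <= orient (~~ b) r).
Proof. by rewrite -!flip_orient leflip. Qed.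

Lemma nestedC r s : nested r s -> nested s r.
Proof. by case=> b [c]; rewrite le_orientC; exists (~~ c), (~~ b). Qed.

Lemma nestedxx r : nested r r.
Proof. by exists false, false. Qed.

Lemma nested_orient b c r s : nested r s -> nested (orient b r) (orient c s).
Proof.
move=> [b' [c' le_rs]]; exists (b' (+) b), (c' (+) c).
by rewrite !orient_addb -!addbA !addbb !addbF.
Qed.

Lemma cornerC r s b c : corner r s (b, c) = corner s r (c, b).
Proof. exact: joinC. Qed.

Lemma nested_corner r s c : nested (corner r s c) r.
Proof. by apply: nestedC; exists c.1, false; apply: leUl. Qed.

(** An orientation of [t] below one of the two joined separations is below the corner. Otherwise
    orientations of [t] lie below both of their inverses: if these orientations agree, they are
    below the inverse of the corner; if not, [r] and [s] are nested through [t]. *)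
Lemma nested_corner_crossing t r s c :
  ~ nested r s -> nested t r -> nested t s -> nested t (corner r s c).
Proof.
case: c => [b c] cross [b1 [c1 tr]] [b2 [c2 ts]].
have [c1b|/eqP] := eqVneq c1 b.
  by exists b1, false; apply: le_trans tr _; rewrite c1b; apply: leUl.
have [c2c|/eqP] := eqVneq c2 c.
  by exists b2, false; apply: le_trans ts _; rewrite c2c; apply: leUr.
move=> c2c c1b.
have {c2c} c2c : c2 = ~~ c by case: c2 c c2c {ts} => [] [].
have {c1b} c1b : c1 = ~~ b by case: c1 b c1b {tr} => [] [].
have [b12|nb12] := eqVneq b1 b2.
  exists b1, true; rewrite /= flip_join !flip_orient lexI.
  by rewrite -c1b -c2c tr b12 ts.
have {nb12} b12 : b1 = ~~ b2 by case: b1 b2 nb12 {tr ts} => [] [].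
case: cross; exists b, c2; rewrite -[b]negbK -c1b.
by rewrite (le_trans _ ts)// le_orientC negbK -b12.
Qed.

Definition splinter A B := forall a b, A a -> B b -> ~ nested a b ->
  [\/ B a, A b | exists c, A (corner a b c) \/ B (corner a b c)].

Lemma splinterC A B : splinter A B -> splinter B A.
Proof.
move=> AB b a Bb Aa crs; case: (AB a b Aa Bb) => [/nestedC//|||[[c e] ABc]].
- by constructor 2.
- by constructor 1.
- by constructor 3; exists (e, c); rewrite cornerC; case: ABc; [right|left].
Qed.

(** Lets the induction continue among the separations nested with a chosen [t]: the corners that may
    be needed are again nested with [t]. *)
Lemma splinter_restrict t A B : splinter A B ->
  splinter [set a | A a /\ nested t a] [set b | B b /\ nested t b].
Proof.
move=> AB a b [Aa ta] [Bb tb] crs; case: (AB a b Aa Bb crs).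
- by constructor 1.
- by constructor 2.
- move=> [c ABc]; constructor 3; exists c.
  by case: ABc; [left|right]; split=> //; apply: nested_corner_crossing.
Qed.

(** The last clause serves the induction: for the restricted sets it says that all representatives
    are nested with the chosen separation. *)
Lemma splinter_lemma (I : eqType) (u : seq I) (A : I -> set U) :
  (forall i, i \in u -> exists a, A i a) ->
  {in u &, forall i j, splinter (A i) (A j)} ->
  exists N : seq U, [/\ {in N &, forall a b, nested a b},
    forall i, i \in u -> exists2 a, a \in N & A i a &
    forall a, a \in N -> exists2 i, i \in u & A i a].
Proof.
elim: u A => [|i u IHu] A A0 spl; first by exists [::]; split.
have ui : i \in i :: u by rewrite mem_head.
have uS j : j \in u -> j \in i :: u by rewrite inE orbC => ->.
have [|j k uj uk|N [nestN NA AN]] := IHu A.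
- by move=> j /uS/A0.
- by apply: spl; apply: uS.
pose crossing (x : U) := [pred a : U | `[< ~ nested x a >]].
have : exists m, `[< exists2 x, A i x & count (crossing x) N = m >].
  by have [x Aix] := A0 i ui; exists (count (crossing x) N);
    apply/asboolP; exists x.
case/ex_minnP => m /asboolP[x Aix <-] min_x.
(* A representative lying in [A i] also serves for [i]; otherwise [x] has to be added. *)
have [[a Na Aia]|noA] := pselect (exists2 a, a \in N & A i a).
  exists N; split=> //; last by move=> b /AN[j /uS]; exists j.
  by move=> j; rewrite inE => /predU1P[->|/NA//]; exists a.
have near_x j : j \in u -> exists a, A j a /\ nested x a.
  move=> uj; have [a Na Aja] := NA j uj.
  have [xa|cross_xa] := pselect (nested x a); first by exists a.
  have [|Aia|[c [Aic|Ajc]]] := spl i j ui (uS j uj) x a Aix Aja cross_xa.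
  - by exists x; split=> //; apply: nestedxx.
  - by case: noA; exists a.
  (* Members of [N] nested with [x] are nested with [a], hence with the corner, while [a] crosses
     [x] but not the corner. This contradicts the choice of [x]. *)
  - have : (count (crossing (corner x a c)) N < count (crossing x) N)%N.
      apply: (@ltn_count _ _ _ _ a) => //=.
      + move=> b Nb /= /asboolP cross_b; apply/asboolP => xb; apply: cross_b.
        apply/nestedC/nested_corner_crossing => //; first exact: nestedC.
        exact: nestN.
      + exact/asboolP.
      + apply/asboolPn; apply; case: (c) => e f; rewrite cornerC.
        exact: nested_corner.
    by rewrite ltnNge min_x//; apply/asboolP; exists (corner x a c).
  - by exists (corner x a c); split=> //; apply/nestedC/nested_corner.
(* [N] only served to choose [x]; new representatives are taken among the separations nested with
   [x]. *)
have [|j k uj uk|M [nestM MA AM]] :=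
    IHu (fun j => [set a | A j a /\ nested x a]%classic).
- by move=> j /near_x[a]; exists a.
- by apply: splinter_restrict; apply: spl; apply: uS.
exists (x :: M); split.
- move=> a b; rewrite !inE => /predU1P[->|Ma] /predU1P[->|Mb].
  + exact: nestedxx.
  + by have [j _ []] := AM b Mb.
  + by have [j _ [_ /nestedC]] := AM a Ma.
  + exact: nestM.
- move=> j; rewrite inE => /predU1P[->|/MA[a Ma [Aja _]]].
    by exists x => //; rewrite mem_head.
  by exists a => //; rewrite inE Ma orbT.
- move=> a; rewrite inE => /predU1P[->|/AM[j uj [Aja _]]]; first by exists i.
  by exists j => //; apply: uS.
Qed.
End Nestedness.

(** * Profiles and the counting of corners *)

Section Profiles.
Context {d : Order.disp_t} {U : universeType d}.
Implicit Types (r s t x y : U) (T P Q : set U).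

Lemma sep_system_orient T b s : sep_system T -> T (orient b s) <-> T s.
Proof.
by move=> sysT; case: b => //=; split=> [/sysT|/sysT//]; rewrite flipK.
Qed.

Lemma profile_join T P x y :
  profile_of T P -> P x -> P y -> T (x `|` y) -> P (x `|` y).
Proof.
move=> [[_ orP] _ nmeet] Px Py /orP[[//|]].
by rewrite flip_join => Pmeet; case: (nmeet x y).
Qed.

Lemma profile_flip_gt T P x y :
  profile_of T P -> P (flip x) -> x < y -> T y -> P (flip y).
Proof.
move=> [[_ orP] consP _] Pfx xy /orP[[Py|//] _].
case: (consP y (flip x)) => //.
by move: xy; rewrite !lt_leAnge !leflip.
Qed.

(** Consistency forbids only strict inequalities, so strictness is what crossing has to provide. *)
Lemma lt_join_crossing b c r s :
  ~ nested r s -> orient c s < orient b r `|` orient c s.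
Proof.
move=> cross; rewrite lt_neqAle leUr andbT; apply/eqP => /esym/join_idPr.
by move=> rs; apply: cross; exists b, c.
Qed.

Lemma orientation_exists T P s :
  orientation_of T P -> T s -> exists b, P (orient b s).
Proof. by move=> [_ orP] /orP[[]]; [exists false|exists true]. Qed.

(** Only two of the four corners lie on the other side of [r]. *)
Lemma three_corners T r s b :
  (3 <= num_corners_in T r s)%N -> exists c, T (corner r s (b, c)).
Proof.
move=> le3; apply: contrapT => /forallNP noc.
suff sub : [pred c | `[< T (corner r s c) >]]
    \subset [set (~~ b, false); (~~ b, true)].
  by have := leq_trans le3 (subset_leq_card sub); rewrite cards2; case: eqP.
apply/fintype.subsetP => -[b' c] /asboolP Tc.
have [bb'|] := eqVneq b' b; first by case: (noc c); rewrite -bb'.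
by rewrite !inE; case: b b' c {noc Tc} => [] [] [].
Qed.

Lemma two_corners T r s b : (2 <= num_corners_in T r s)%N ->
  (exists c, T (corner r s (b, c))) \/ forall c, T (corner r s (~~ b, c)).
Proof.
move=> le2; apply: contrapT => /not_orP[/forallNP noc /existsNP[c nTc]].
suff sub : [pred c | `[< T (corner r s c) >]] \subset [set (~~ b, ~~ c)].
  by have := leq_trans le2 (subset_leq_card sub); rewrite cards1.
apply/fintype.subsetP => -[b' c'] /asboolP Tc.
have [bb'|nbb'] := eqVneq b' b; first by case: (noc c'); rewrite -bb'.
have bb' : b' = ~~ b by case: b b' nbb' {noc Tc nTc} => [] [].
have [cc'|] := eqVneq c' c; first by case: nTc; rewrite -cc' -bb'.
by rewrite !inE bb' xpair_eqE eqxx; case: c c' {nTc Tc} => [] [].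
Qed.
End Profiles.

(** * Efficient distinguishers in a compatible sequence *)

Section Efficient.
Context {d : Order.disp_t} {U : universeType d} {n : nat}.
Variable S : 'I_n.+1 -> set U.
Hypothesis Ssys : forall i, sep_system (S i).
Arguments Ssys : clear implicits.
Hypothesis Schain :
  forall i j : 'I_n.+1, (i <= j)%N -> forall s, S i s -> S j s.
Arguments Schain {i j} _ [s] _.
Implicit Types (r s t : U) (P Q : set U) (i j k : 'I_n.+1).

Lemma distinguishesC s P Q : distinguishes S s P Q -> distinguishes S s Q P.
Proof.
move=> [Ss [b [Pb Qb]]]; split=> //; exists (~~ b).
by rewrite -flip_orient flipK.
Qed.

Lemma distinguishesI k s P Q :
  S k s -> P s -> Q (flip s) -> distinguishes S s P Q.
Proof.
move=> Ss Ps Qs; split; last by exists false.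
exact: (Schain (j := ord_max) (leq_ord k) Ss).
Qed.

Lemma profile_distinguished k s P Q :
  profile_of (S k) P -> distinguishes S s P Q -> S k s.
Proof.
move=> [[PS _] _ _] [_ [b [/PS Sbs _]]].
exact: ((sep_system_orient b s (Ssys k)).1 Sbs).
Qed.

(** The first index at which [P] and [Q] become distinguishable; efficiency then reduces to
    membership in the single system [S i]. *)
Definition level i P Q :=
  (exists2 s, S i s & distinguishes S s P Q) /\
  forall k, (exists2 s, S k s & distinguishes S s P Q) -> (i <= k)%N.

Lemma levelP P Q : (exists s, distinguishes S s P Q) -> exists i, level i P Q.
Proof.
move=> [s sPQ].
pose has_dist i := `[< exists2 s, S i s & distinguishes S s P Q >].
have max_dist : has_dist ord_max by apply/asboolP; exists s => //; case: sPQ.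
case: (arg_minnP (fun i => i) max_dist) => i /asboolP iPQ min_i.
by exists i; split=> // k kPQ; apply/min_i/asboolP.
Qed.

Lemma level_efficient i s P Q : level i P Q ->
  distinguishes_efficiently S s P Q <-> S i s /\ distinguishes S s P Q.
Proof.
move=> [iPQ min_i]; split=> [[sPQ eff]|[Sis sPQ]].
  by split=> //; apply: eff.
by split=> // k /min_i ik; exact: (Schain ik Sis).
Qed.

(** A profile orients whatever distinguishes it from another one. Hence it also orients every corner
    found in [S i]. *)
Lemma level_profile i k P Q : level i P Q -> profile_of (S k) P -> (i <= k)%N.
Proof.
move=> [[s _ sPQ] min_i] profP; apply: min_i; exists s => //.
exact: profile_distinguished sPQ.
Qed.

Lemma levelC i P Q : level i P Q -> level i Q P.
Proof.
move=> [[s Ss /distinguishesC sPQ] min_i]; split; first by exists s.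
by move=> k [t St /distinguishesC tPQ]; apply: min_i; exists t.
Qed.

Hypothesis Scompat : compatible S.
Variable PP : set (set U).
Hypothesis PPprof : forall P, PP P -> profile_in S P.
Hypothesis PProbust : robust S PP.
Arguments PProbust [P Q Q'] _ _ _ [r] _ _ _ [s] _ [j] _.
Arguments Scompat [i j] _ [si sj] _ _.
Arguments PPprof [P] _.

(** The profile containing [orient c s] contains the corner by the profile property; the other
    contains its inverse by consistency. *)
Lemma corner_distinguishes j r s P Q b c :
  PP P -> PP Q -> level j P Q -> ~ nested r s ->
  P (orient b r) -> Q (orient b r) ->
  distinguishes S s P Q -> S j (corner r s (b, c)) ->
  distinguishes S (corner r s (b, c)) P Q.
Proof.
move=> PPP PPQ lev cross.
have [[k profP] [l profQ]] := (PPprof PPP, PPprof PPQ).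
have [jk jl] := (level_profile lev profP, level_profile (levelC lev) profQ).
move=> Pr Qr [_ [e [Ps Qs]]] Sjc; have lt_c := lt_join_crossing b c cross.
have [ec|] := eqVneq c e; last move=> /eqP nce; [|apply: distinguishesC].
  apply: (distinguishesI Sjc).
    by apply: (profile_join profP) => //=; [rewrite ec|exact: (Schain jk Sjc)].
  by apply: (profile_flip_gt profQ _ lt_c); [rewrite ec|exact: (Schain jl Sjc)].
have {nce} ec : c = ~~ e by case: c e nce {Ps Qs Sjc lt_c} => [] [].
apply: (distinguishesI Sjc).
  apply: (profile_join profQ) => //=; last exact: (Schain jl Sjc).
  by rewrite ec -flip_orient.
apply: (profile_flip_gt profP _ lt_c); last exact: (Schain jk Sjc).
by rewrite ec flip_orient negbK.
Qed.

Lemma robust_corner i j r s P P' Q Q' b :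
  PP P -> PP P' -> PP Q -> PP Q' -> level i P P' -> ~ nested r s ->
  P (flip (orient b r)) -> P' (orient b r) ->
  Q (orient b r) -> Q' (orient b r) ->
  distinguishes_efficiently S s Q Q' -> S j s ->
  (forall c, ~ S j (corner r s (b, c))) ->
  (forall c, S i (corner r s (~~ b, c))) ->
  exists c, distinguishes S (corner r s (~~ b, c)) P P'.
Proof.
move=> PPP PPP' PPQ PPQ' lev cross Pr P'r Qr Q'r sQQ' Sjs noj Sic.
(* Robustness offers a corner in [P] or one in [S j] on side [b]; the latter is excluded by
   [noj]. *)
have [c [Pc|/noj//]] := PProbust PPP PPQ PPQ' Qr Q'r Pr sQQ' Sjs.
exists c; apply: (distinguishesI (Sic c)).
  by rewrite /corner /= -flip_orient.
have [l profP'] := PPprof PPP'.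
have il := level_profile (levelC lev) profP'.
have lt_c : orient (~~ b) r < corner r s (~~ b, c).
  by rewrite cornerC; apply: lt_join_crossing => /nestedC.
apply: (profile_flip_gt profP' _ lt_c); last exact: (Schain il (Sic c)).
by rewrite flip_orient negbK.
Qed.

Lemma efficient_splinter_le i j P P' Q Q' :
  PP P -> PP P' -> PP Q -> PP Q' ->
  level i P P' -> level j Q Q' -> (i <= j)%N ->
  splinter [set s | distinguishes_efficiently S s P P']
           [set s | distinguishes_efficiently S s Q Q'].
Proof.
move=> PPP PPP' PPQ PPQ' levi levj ij r s rPP' sQQ' cross.
have [Sir dr] := (level_efficient r levi).1 rPP'.
have [Sjs ds] := (level_efficient s levj).1 sQQ'.
have Sjr := Schain ij Sir.
have [dr'|ndr] := pselect (distinguishes S r Q Q').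
  by constructor 1; apply/(level_efficient r levj).
constructor 3.
have [[k profQ] [l profQ']] := (PPprof PPQ, PPprof PPQ').
have [jk jl] := (level_profile levj profQ, level_profile (levelC levj) profQ').
have [b Qr] : exists b, Q (orient b r).
  by case: profQ => /orientation_exists + _ _; apply; exact: (Schain jk Sjr).
have Q'r : Q' (orient b r).
  have [b' Q'r] : exists b, Q' (orient b r).
    by case: profQ' => /orientation_exists + _ _; apply; exact: (Schain jl Sjr).
  (* Opposite orientations of [r] would make it distinguish [Q] from [Q']. *)
  have [->//|nbb'] := eqVneq b b'; case: ndr; split; first by case: dr.
  exists b; split=> //; rewrite flip_orient.
  by case: b b' nbb' Q'r {Qr} => [] [].
have [[c Sjc]|/forallNP noj] := pselect (exists c, S j (corner r s (b, c))).
  exists (b, c); right; apply/(level_efficient _ levj); split=> //.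
  exact: (corner_distinguishes PPQ PPQ' levj).
(* With no corner on side [b] in [S j], three corners there are impossible, and two in [S i] must be
   both corners of the other side. *)
have Sic c : S i (corner r s (~~ b, c)).
  case: (Scompat ij Sir Sjs) => [/(two_corners b)[[e /(Schain ij)/noj//]|//]|].
  by move=> /(three_corners b)[e /noj].
suff [c dc] : exists c, distinguishes S (corner r s (~~ b, c)) P P'.
  by exists (~~ b, c); left; apply/(level_efficient _ levi).
have [_ [e [Pr P'r]]] := dr.
(* Robustness is applied to whichever of [P] and [P'] orients [r] differently from [Q] and [Q']. *)
have [be|nbe] := eqVneq e b; last first.
  have {nbe} be : e = ~~ b by case: e b nbe {Qr Q'r noj Sic Pr P'r} => [] [].
  apply: (robust_corner PPP PPP' PPQ PPQ' levi cross
    _ _ Qr Q'r sQQ' Sjs noj Sic).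
  - by rewrite flip_orient -be.
  - by rewrite -[b]negbK -be -flip_orient.
have [||c dc] := robust_corner PPP' PPP PPQ PPQ' (levelC levi) cross
  _ _ Qr Q'r sQQ' Sjs noj Sic.
- by rewrite -be.
- by rewrite -be.
by exists c; apply: distinguishesC.
Qed.

Lemma efficient_splinter P P' Q Q' :
  PP P -> PP P' -> PP Q -> PP Q' ->
  (exists s, distinguishes S s P P') -> (exists s, distinguishes S s Q Q') ->
  splinter [set s | distinguishes_efficiently S s P P']
           [set s | distinguishes_efficiently S s Q Q'].
Proof.
move=> PPP PPP' PPQ PPQ' /levelP[i levi] /levelP[j levj].
have [ij|/ltnW ji] := leqP i j; first exact: efficient_splinter_le ij.
by apply: splinterC; apply: efficient_splinter_le ji.
Qed.
End Efficient.

Theorem theorem4 (d : Order.disp_t) (U : universeType d) (n : nat)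
    (S : 'I_n.+1 -> set U) (PP : set (set U))
    (Ssys : forall i : 'I_n.+1, sep_system (S i))
    (Ssubmod : forall i : 'I_n.+1, submodular (S i))
    (Schain : forall i j : 'I_n.+1, (i <= j)%N -> forall s : U, S i s -> S j s)
    (Scompat : compatible S)
    (PPfin : finite_set PP)
    (PPprof : forall P : set U, PP P -> profile_in S P)
    (PProbust : robust S PP) :
  exists N : set U,
    [/\ sep_system N, nested_set N & efficiently_distinguishes_all S N PP].
Proof.
pose pairs := [set PQ : set U * set U |
  [/\ PP PQ.1, PP PQ.2 & exists s, distinguishes S s PQ.1 PQ.2]]%classic.
have /finite_seqP[u def_u] : finite_set pairs.
  apply: sub_finite_set (finite_setX PPfin PPfin).
  by move=> PQ [].
have uP PQ : reflect (pairs PQ) (PQ \in u).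
  by apply: (iffP idP); rewrite def_u.
pose A (PQ : set U * set U) :=
  [set s | distinguishes_efficiently S s PQ.1 PQ.2]%classic.
have [||N [nestN NA _]] := @splinter_lemma _ U _ u A.
- move=> PQ /uP[_ _ /levelP[i lev]]; have [[s Ss sPQ] _] := lev.
  by exists s; apply/(level_efficient Schain s lev).
- by move=> PQ PQ' /uP[? ? ?] /uP[? ? ?];
    exact: (efficient_splinter Ssys Schain Scompat PPprof PProbust).
(* Closing under [flip] turns the representatives into a set of unoriented separations; nestedness
   ignores orientations. *)
exists [set s | exists b, exists2 t, t \in N & s = orient b t]%classic; split.
- by move=> _ [b [t Nt ->]]; exists (~~ b), t => //; rewrite flip_orient.
- by move=> _ _ [b [t Nt ->]] [c [t' Nt' ->]]; apply/nested_orient/nestN.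
- move=> P Q PPP PPQ PQ; have [|s Ns sPQ] := NA (P, Q); first exact/uP.
  by exists s => //; exists false, s.
Qed.
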